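(* Let $G$ be a connected graph of order $n$ with radius $\mathrm{rad}(G) \geq 3$. Then $\mathrm{vp}(G) \leq n - \mathrm{rad}(G) - 1$.
   Context: All graphs are finite, undirected and simple. A $u,v$-geodesic is a shortest $u,v$-path. The radius $\mathrm{rad}(G)$ is the minimum over vertices $x$ of the eccentricity $\max_{v \in V(G)} d(x,v)$. For a vertex $x$ of $G$, a set $S \subseteq V(G)$ is an $x$-position set if for every $y \in S$ no vertex of $S \setminus \{y\}$ lies on any $x,y$-geodesic in $G$. The $x$-position number $p_x(G)$ is the maximum cardinality of an $x$-position set of $G$. Define $\mathrm{vp}(G) = \max_{x \in V(G)} p_x(G)$. *)

(* Defs.v *)
From mathcomp Require Import all_boot.
Set Implicit Arguments.
Unset Strict Implicit.
Unset Printing Implicit Defensive.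

(* A finite simple graph is a symmetric irreflexive relation e on a finType T;
   its order is #|T|. *)
Section Graph.
Variables (T : finType) (e : rel T).
Implicit Types (u v x y : T) (p : seq T) (S : {set T}).

Definition graph_connected : Prop := forall u v, connect e u v.

(* u :: p is the full vertex sequence, so the length (number of edges) is
   size p. *)
Definition uv_path u v p : bool :=
  [&& path e u p, last u p == v & uniq (u :: p)].

(* Paths have length < #|T|; the default value #|T| is only attained when
   there is no path from u to v. *)
Definition dist u v : nat :=
  \big[minn/#|T|]_(k < #|T| | [exists p : k.-tuple T, uv_path u v p]) k.

Definition geodesic u v p : bool := uv_path u v p && (size p == dist u v).

Definition eccentricity x : nat := \max_(v : T) dist x v.

(* The default #|T| bounds every eccentricity, hence does not affect the
   minimum; on the empty graph it makes the radius 0. *)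
Definition radius : nat := \big[minn/#|T|]_(x : T) eccentricity x.

Definition position_set x S : bool :=
  [forall y in S, [forall p : (dist x y).-tuple T,
     geodesic x y p ==> [disjoint S :\ y & x :: p]]].

Definition position_number x : nat :=
  \max_(S : {set T} | position_set x S) #|S|.

Definition vp : nat := \max_(x : T) position_number x.

End Graph.

(* Main.v *)
Require Import Defs.
From mathcomp Require Import all_boot.
From mathcomp Require Import zify.

(** A geodesic P from x meets an x-position set S in at most one vertex.  Take P
    of length ecc(x) >= rad(G): if S missed at most rad(G) vertices, then
    ecc(x) = rad(G) and P and S would cover the graph.  Let p1 be the second
    vertex of P.  A vertex of S at distance at least 2 from x and off P has a
    geodesic from x whose second vertex is outside S, hence on P, hence equal to
    p1.  So p1 is nearer than x to all vertices except possibly those within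
    distance 2, and ecc(p1) < rad(G) as soon as rad(G) >= 3. *)

Lemma bigminn_le (I : eqType) (s : seq I) (P : pred I) (F : I -> nat) d i :
  i \in s -> P i -> \big[minn/d]_(j <- s | P j) F j <= F i.
Proof.
elim: s => // j s IHs; rewrite inE big_cons => /predU1P[<- ->|/IHs{}IHs /IHs].
  exact: geq_minl.
by case: ifP => // _; apply: leq_trans; exact: geq_minr.
Qed.

(** The strict bound excludes the default [d], which is also the value of an empty minimum. *)
Lemma bigminn_attained (I : Type) (s : seq I) (P : pred I) (F : I -> nat) d :
  \big[minn/d]_(j <- s | P j) F j < d ->
  exists2 i, P i & \big[minn/d]_(j <- s | P j) F j = F i.
Proof.
elim/big_ind: _ => [|a b IHa IHb|i Pi _]; last by exists i.
  by rewrite ltnn.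
by rewrite /minn; case: ifP.
Qed.

Section Geodesics.
Variables (T : finType) (e : rel T).
Implicit Types (u v x y z : T) (p q : seq T) (S : {set T}).

Lemma uniq_size_lt u p : uniq (u :: p) -> size p < #|T|.
Proof. by move/card_uniqP => /= <-; exact: max_card. Qed.

(** [dist] only ranges over duplicate-free paths, so [p] is first shortened to such a path, whose
    length is below [#|T|] and hence a legal index. *)
Lemma dist_le_size u v p : path e u p -> last u p = v -> dist e u v <= size p.
Proof.
move=> ep lastv; case: (shortenP ep) lastv => q eq uq sub lastv.
have size_q := uniq_size_lt _ _ uq.
apply: (@leq_trans (size q)); last first.
  by apply: uniq_leq_size => //; case/andP: uq.
rewrite /dist.
apply: (@bigminn_le _ _ _ (fun k : 'I_#|T| => k : nat) _ (Ordinal size_q)).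
  exact: mem_index_enum.
by apply/existsP; exists (in_tuple q); rewrite /uv_path eq lastv eqxx.
Qed.

Lemma geodesic_exists u v : connect e u v -> exists p, geodesic e u v p.
Proof.
case/connectP=> p ep ->; case: (shortenP ep) => q eq uq _.
have lt_dist : dist e u (last u q) < #|T|.
  apply: leq_ltn_trans (dist_le_size _ _ _ eq erefl) _.
  exact: uniq_size_lt uq.
case: (bigminn_attained _ _ _ _ _ lt_dist) => k /existsP[r uvr] dk.
by exists r; rewrite /geodesic uvr size_tuple /dist dk eqxx.
Qed.

(** A shorter path to [z], continued by [q], would beat the geodesic to [y]. *)
Lemma geodesic_prefix x y z p q :
  geodesic e x y (rcons p z ++ q) -> geodesic e x z (rcons p z).
Proof.
case/andP=> /and3P[]; rewrite cat_path last_cat last_rcons => /andP[ep eq] lq.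
rewrite -cat_cons cat_uniq => /andP[up _] /eqP size_pq.
rewrite /geodesic /uv_path ep last_rcons eqxx up /=.
rewrite eqn_leq (dist_le_size _ _ _ ep (last_rcons _ _ _)) andbT.
case: (leqP (size (rcons p z)) (dist e x z)) => // short.
have lt_dist : dist e x z < #|T| by exact: ltn_trans short (uniq_size_lt _ _ up).
have [k /existsP[s /and3P[es /eqP ls _]] dk] := bigminn_attained _ _ _ _ _ lt_dist.
rewrite -/(dist e x z) in dk.
have : dist e x y <= size (s ++ q).
  apply: dist_le_size; first by rewrite cat_path es ls.
  by rewrite last_cat ls; apply/eqP.
by rewrite -size_pq !size_cat size_tuple leq_add2r -dk leqNgt short.
Qed.

(** If [z] came after [w], the prefix ending at [z] would be a geodesic with at least two edges,
    against the edge from [x] to [z]. *)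
Lemma geodesic_neighbour x y z w p :
  geodesic e x y (w :: p) -> e x z -> z \in w :: p -> z = w.
Proof.
move=> geo exz; rewrite inE => /predU1P[//|zp].
case/splitPr: zp geo => p1 p2; rewrite -cat_rcons -cat_cons -rcons_cons => geo.
case/andP: (geodesic_prefix _ _ _ _ _ geo) => _ /eqP size_p.
have : dist e x z <= size [:: z] by apply: dist_le_size; rewrite /= ?exz.
by rewrite -size_p size_rcons.
Qed.

Lemma position_set_geodesic x y z p S :
  position_set e x S -> geodesic e x y p -> y \in S -> z \in S ->
  z \in x :: p -> z = y.
Proof.
move=> /forall_inP posS geo yS zS zp.
have /eqP size_p : size p == dist e x y by case/andP: geo.
have /forallP/(_ (tcast size_p (in_tuple p))) := posS y yS.
rewrite val_tcast geo => /= /disjointFl/(_ zp).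
by rewrite !inE zS andbT => /eqP.
Qed.

(** The endpoint [y] may lie outside [S]: the path is cut at the later of [a] and [b], which leaves
    a geodesic ending in [S]. *)
Lemma position_set_geodesic_inj x y a b p S :
  position_set e x S -> geodesic e x y p -> a \in S -> b \in S ->
  a \in x :: p -> b \in x :: p -> a = b.
Proof.
move=> posS geo aS bS ap bp.
have prefix c d q1 q2 : p = rcons q1 d ++ q2 -> c \in S -> d \in S ->
    c \in x :: rcons q1 d -> c = d.
  move=> Ep cS dS; rewrite Ep in geo.
  apply: (position_set_geodesic _ _ _ _ S) dS cS => //.
  exact: geodesic_prefix geo.
move: bp; rewrite inE => /predU1P[Eb|bp].
  move: ap; rewrite inE => /predU1P[->//|ap].
  case/splitPr: ap prefix => q1 q2; rewrite -cat_rcons => prefix.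
  by apply/esym/prefix; rewrite // Eb mem_head.
case/splitPr: bp ap prefix => q1 q2; rewrite -cat_rcons => ap prefix.
move: ap; rewrite -cat_cons mem_cat => /orP[ap|ap]; first exact: (prefix a b q1 q2).
case/splitPr: ap prefix => r1 r2 prefix.
apply/esym/(prefix b a (rcons q1 b ++ r1) r2) => //.
  by rewrite [RHS]cat_rcons -catA.
by rewrite inE mem_rcons inE mem_cat mem_rcons mem_head !orbT.
Qed.

Lemma card_geodesic_diff x y p S :
  position_set e x S -> geodesic e x y p ->
  size p <= #|[set z in x :: p] :\: S|.
Proof.
move=> posS geo.
have card_p : #|[set z in x :: p]| = (size p).+1.
  by rewrite cardsE; apply/card_uniqP; case/andP: geo => /and3P[].
have : #|[set z in x :: p] :&: S| <= 1.
  apply/card_le1_eqP => a b; rewrite !inE => /andP[ap aS] /andP[bp bS].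
  by apply: (position_set_geodesic_inj x y _ _ p S) posS geo _ _ _ _; rewrite ?inE.
have := cardsID S [set z in x :: p]; lia.
Qed.

Hypotheses (e_sym : symmetric e) (e_conn : graph_connected e).

Lemma eccentricity_attained x :
  exists y p, geodesic e x y p /\ size p = eccentricity e x.
Proof.
have [y Ey] : exists y, eccentricity e x = dist e x y.
  by rewrite /eccentricity (bigmax_eq_arg x) //; eexists.
case: (geodesic_exists _ _ (e_conn x y)) => p geo.
by exists y, p; split=> //; rewrite Ey; apply/eqP; case/andP: geo.
Qed.

Lemma eccentricity_neighbour x y w p S :
  position_set e x S -> geodesic e x y (w :: p) ->
  size (w :: p) = eccentricity e x -> ~: S \subset x :: w :: p ->
  eccentricity e w <= maxn 2 (size p).
Proof.
move=> posS geo size_p cover; apply/bigmax_leqP => v _.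
have /and3P[/= /andP[exw ewp] _ _] : uv_path e x y (w :: p) by case/andP: geo.
have ewx : e w x by rewrite e_sym.
rewrite leq_max; case: (boolP (v \in x :: w :: p)) => [|vNp].
  rewrite inE => /predU1P[->|vp].
    by rewrite (leq_trans (dist_le_size w x [:: x] _ _)) //= ewx.
  case/splitPl: vp ewp => p1 p2 lastv; rewrite cat_path => /andP[ep1 _].
  apply/orP; right; apply: leq_trans (dist_le_size _ _ _ ep1 _) _ => //.
  by rewrite size_cat leq_addr.
have inS z : z \notin x :: w :: p -> z \in S.
  by apply: contraR; rewrite -in_setC => /(subsetP cover).
case: (geodesic_exists _ _ (e_conn x v)) => [[|z q] geoq].
  by case/andP: geoq vNp => /and3P[_ /eqP/= <-]; rewrite mem_head.
(* No geodesic from [x] is longer than [w :: p], which attains the eccentricity. *)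
have size_q : size (z :: q) <= size (w :: p).
  case/andP: (geoq) => _ /eqP ->; rewrite size_p.
  exact: (leq_bigmax (F := dist e x)).
have /and3P[/= /andP[exz ezq] /eqP lastv uq] : uv_path e x v (z :: q).
  by case/andP: geoq.
(* A neighbour [v] of [x] is reached from [w] through [x]; hence the 2 in the bound. *)
case: (eqVneq z v) => [Ez|z_neq_v].
  rewrite (leq_trans (dist_le_size w v [:: x; v] _ _)) //=.
  by rewrite ewx -Ez exz.
(* Now [z] is an interior vertex of a geodesic ending at [v], which is in [S]. *)
have zNS : z \notin S.
  apply: contra z_neq_v => zS; apply/eqP.
  apply: position_set_geodesic posS geoq (inS v vNp) zS _.
  by rewrite !inE eqxx orbT.
have Ez : z = w.
  have : z \in x :: w :: p by apply: contraR zNS => /inS.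
  rewrite inE => /predU1P[Ezx|]; last exact: geodesic_neighbour geo exz.
  by rewrite Ezx /= mem_head in uq.
rewrite -Ez in geo *.
by apply/orP; right; apply: leq_trans (dist_le_size _ _ _ ezq lastv) _.
Qed.

End Geodesics.

Theorem theorem2p11 (T : finType) (e : rel T) (n : nat)
  (e_sym : symmetric e) (e_irr : irreflexive e)
  (order_n : #|T| = n)
  (e_conn : graph_connected e)
  (rad_ge3 : 3 <= radius e) :
  vp e <= n - radius e - 1.
Proof.
apply/bigmax_leqP => x _; apply/bigmax_leqP => S posS.
have card_S : #|S| + #|~: S| = n by rewrite cardsC.
suff : radius e < #|~: S| by lia.
rewrite ltnNge; apply/negP => small.
have rad_le z : radius e <= eccentricity e z.
  by apply: bigminn_le => //; exact: mem_index_enum.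
have [y [p [geo size_p]]] := eccentricity_attained _ _ e_conn x.
have := card_geodesic_diff _ _ _ _ _ _ posS geo; rewrite size_p => card_diff.
have sub : [set z in x :: p] :\: S \subset ~: S.
  by rewrite setDE subsetIr.
have rad_x := rad_le x.
(* The chain [#|~: S| <= radius e <= eccentricity e x <= #|[set z in x :: p] :\: S|] closes up by
   inclusion, so all its terms are equal. *)
have /eqP E : [set z in x :: p] :\: S == ~: S by rewrite eqEcard sub; lia.
have ecc_x : eccentricity e x = radius e.
  by apply/eqP; rewrite eqn_leq rad_x andbT (leq_trans card_diff) // E.
have cover : ~: S \subset x :: p.
  by apply/subsetP => z; rewrite -E !inE => /andP[].
case: p geo size_p cover {card_diff sub E} => [|w p] geo size_p cover.
  by move: size_p => /=; lia.
have := eccentricity_neighbour _ _ e_sym e_conn _ _ _ _ _ posS geo size_p cover.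
(* Here [size p] is [radius e - 1], so [radius e <= maxn 2 (radius e - 1)], which fails from radius
   3 on. *)
have := rad_le w; move: size_p => /=; lia.
Qed.
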